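(* Let $\mathfrak X_1,\dots,\mathfrak X_N,\mathfrak Y\in\mathfrak{GM}$ and $\rho\in\Delta_{N-1}$ be fixed. Then every $\mathfrak Z\in\widetilde{\mathrm{TB}}_\rho(\mathfrak Y)$ satisfies $$\mathcal F_\rho(\mathfrak Y)\ \ge\ \mathcal F_\rho(\mathfrak Z)+\mathrm{GW}^2(\mathfrak Y,\mathfrak Z),\qquad \mathcal F_\rho(\mathfrak W):=\sum_{i=1}^N\rho_i\,\mathrm{GW}^2(\mathfrak X_i,\mathfrak W)\quad(\mathfrak W\in\mathfrak{GM}).$$ In particular, every barycenter $\mathfrak Y$ (i.e. every minimizer of $\mathcal F_\rho$ over $\mathfrak{GM}$) is a fixpoint of $\widetilde{\mathrm{TB}}_\rho$, i.e. $\mathfrak Z=\mathfrak Y$ for every $\mathfrak Z\in\widetilde{\mathrm{TB}}_\rho(\mathfrak Y)$.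
   Context: A gauged measure space (gm-space) is a triple $\mathbb X=(X,g,\xi)$ where $X$ is a Polish space, $\xi$ is a Borel probability measure on $X$, and $g$ is a gauge, i.e. $g\in L^2_{\mathrm{sym}}(X\times X,\xi\otimes\xi)$ (symmetric, real-valued, square-integrable). For gm-spaces $\mathbb X=(X,g,\xi)$, $\mathbb Y=(Y,h,\upsilon)$, $\Pi(\mathbb X,\mathbb Y)$ is the set of Borel probability measures on $X\times Y$ with marginals $\xi,\upsilon$; $F_{\mathrm{GW}}^{\mathbb X,\mathbb Y}(\pi):=\bigl(\iint |g(x,x')-h(y,y')|^2\,d\pi(x,y)\,d\pi(x',y')\bigr)^{1/2}$; $\mathrm{GW}(\mathbb X,\mathbb Y):=\inf_{\pi\in\Pi(\mathbb X,\mathbb Y)}F_{\mathrm{GW}}^{\mathbb X,\mathbb Y}(\pi)$ (the infimum is attained), and $\Pi_{\mathrm o}(\mathbb X,\mathbb Y)$ is the set of minimizers. Spaces are homomorphic, $\mathbb X\simeq\mathbb Y$, if $\mathrm{GW}(\mathbb X,\mathbb Y)=0$; $\llbracket\mathbb X\rrbracket$ denotes the equivalence class and $\mathfrak{GM}$ the set of all classes, which is a metric space under $\mathrm{GW}(\llbracket\mathbb X\rrbracket,\llbracket\mathbb Y\rrbracket):=\mathrm{GW}(\mathbb X,\mathbb Y)$. $\Delta_{N-1}:=\{\rho\in[0,1]^N:\sum_i\rho_i=1\}$. Let $\mathbb X_i=(X_i,g_i,\xi_i)\in\mathfrak X_i$ be representatives, $X_\times:=X_1\times\cdots\times X_N$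 and $m_\rho(x_\times,x_\times'):=\sum_{i=1}^N\rho_i g_i(x_i,x_i')$. For $\mathbb Y=(Y,h,\upsilon)$ and $\pi_i\in\Pi(\mathbb Y,\mathbb X_i)$ let $\Gamma_{\mathbb Y}(\pi_1,\dots,\pi_N)$ be the set of Borel probability measures $\gamma$ on $Y\times X_\times$ with $(P_{Y\times X_i})_\#\gamma=\pi_i$ for all $i$ (gluings), and $\mathrm M_{\mathbb Y}(\pi_1,\dots,\pi_N):=\{(P_{X_\times})_\#\gamma:\gamma\in\Gamma_{\mathbb Y}(\pi_1,\dots,\pi_N)\}$ (meltings); $P_\bullet$ is the projection onto the indicated components and $\#$ the push-forward. For $\mathbb Y\in\mathfrak Y$ put $$\mathrm M^{\mathrm o}_{\mathfrak Y}(\mathbb X_1,\dots,\mathbb X_N):=\{\mu\in\mathrm M_{\mathbb Y}(\pi_1,\dots,\pi_N):\pi_i\in\Pi_{\mathrm o}(\mathbb Y,\mathbb X_i),\ i=1,\dots,N\},$$ $$\widetilde{\mathrm{TB}}_\rho(\mathfrak Y):=\{\llbracket(X_\times,m_\rho,\mu)\rrbracket:\mu\in\mathrm M^{\mathrm o}_{\mathfrak Y}(\mathbb X_1,\dots,\mathbb X_N)\}.$$ These sets do not depend on the representative $\mathbb Y\in\mathfrak Y$, and $\widetilde{\mathrm{TB}}_\rho(\mathfrak Y)$ does not depend on the representatives $\mathbb X_i\in\mathfrak X_i$. *)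

(* Defs.v *)
From HB Require Import structures.
From mathcomp Require Import all_boot all_order all_algebra.
From mathcomp Require Import all_classical all_reals all_analysis.
From mathcomp Require Import measurable_realfun.

Set Implicit Arguments.
Unset Strict Implicit.
Unset Printing Implicit Defensive.

Import Order.TTheory GRing.Theory Num.Theory.
Import numFieldNormedType.Exports.

Local Open Scope classical_set_scope.
Local Open Scope ring_scope.

HB.instance Definition _ (T U : ptopologicalType) := Pointed.on (T * U)%type.

(* Finite product of spaces with the product topology; an alias of
   prod_topology that is also a ptopologicalType. *)
Definition xprod (N : nat) (X : 'I_N -> ptopologicalType) : Type :=
  prod_topology X.
HB.instance Definition _ N (X : 'I_N -> ptopologicalType) :=
  Topological.copy (xprod X) (prod_topology X).
HB.instance Definition _ N (X : 'I_N -> ptopologicalType) :=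
  isPointed.Build (xprod X) (fun=> point).

(* T with its Borel sigma-algebra. Beware that borel (T * U) carries the Borel
   sigma-algebra of the product topology, and (borel T * borel U)%type the
   product sigma-algebra; they coincide for Polish spaces. *)
Definition borel (T : ptopologicalType) : Type := T.
Definition borel_display (T : ptopologicalType) : measure_display :=
  sigma_display (@open T).
HB.instance Definition _ (T : ptopologicalType) := Pointed.on (borel T).
HB.instance Definition _ (T : ptopologicalType) :=
  @isMeasurable.Build (borel_display T) (borel T) <<s @open T >>
    (@sigma_algebra0 _ setT _) (@sigma_algebraC _ _)
    (@sigma_algebra_bigcup _ setT _).

Definition separable_space (T : topologicalType) :=
  exists2 S : set T, countable S & dense S.

Definition completely_metrizable (R : realType) (T : topologicalType) :=
  exists d : T -> T -> R,
    [/\ [/\ forall x y, d x y = 0 <-> x = y,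
            forall x y, d x y = d y x
          & forall x y z, d x z <= d x y + d y z],
        forall (x : T) (A : set T),
          nbhs x A <-> exists2 e : R, 0 < e & [set y | d x y < e] `<=` A
      & forall u : nat -> T,
          (forall e : R, 0 < e -> exists n0, forall m n,
             (n0 <= m)%N -> (n0 <= n)%N -> d (u m) (u n) < e) ->
          exists l : T, u @ \oo --> l].

Definition polish (R : realType) (T : topologicalType) :=
  separable_space T /\ completely_metrizable R T.

(* m' is the push-forward of m under f. *)
Definition is_pushforward (R : realType) (T T' : ptopologicalType)
    (m : probability (borel T) R) (f : T -> T') (m' : probability (borel T') R) :=
  forall A : set (borel T'), measurable A ->
    pushforward m (f : borel T -> borel T') A = m' A.

(* The data of a gm-space; the gauge is a function representing its L^2 class. *)
Record gauged (R : realType) := Gauged {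
  gm_space :> ptopologicalType ;
  gm_gauge : gm_space * gm_space -> R ;
  gm_meas : probability (borel gm_space) R }.
Arguments gm_gauge {R} X _ : rename.
Arguments gm_meas {R} X : rename.

(* Equality in L^2 being almost-everywhere equality, so is symmetry. *)
Definition is_gm (R : realType) (X : gauged R) :=
  let xi := gm_meas X in
  [/\ polish R X,
      (gm_gauge X : borel X * borel X -> R) \in Lfun (xi \x xi)%E 2%:E
    & {ae (xi \x xi)%E, forall z, gm_gauge X z = gm_gauge X (z.2, z.1)}].

Record gmspace (R : realType) := GMSpace {
  gm_data :> gauged R ;
  gm_axiom : is_gm gm_data }.

Definition coupling (R : realType) (X Y : gauged R) :
    set (probability (borel (X * Y)%type) R) :=
  [set p : probability (borel (X * Y)%type) R |
     is_pushforward p fst (gm_meas X) /\ is_pushforward p snd (gm_meas Y)].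
Arguments coupling {R} X Y _.

Definition F_GW (R : realType) (X Y : gauged R)
    (p : probability (borel (X * Y)%type) R) : \bar R :=
  sqrte (\int[p]_z \int[p]_z'
    (`|gm_gauge X (z.1, z'.1) - gm_gauge Y (z.2, z'.2)| ^+ 2)%:E)%E.
Arguments F_GW {R} X Y p.

Definition GW (R : realType) (X Y : gauged R) : \bar R :=
  ereal_inf [set F_GW X Y p | p in coupling X Y].

Definition optimal_coupling (R : realType) (X Y : gauged R) :
    set (probability (borel (X * Y)%type) R) :=
  [set p | coupling X Y p /\
     forall q, coupling X Y q -> (F_GW X Y p <= F_GW X Y q)%E].
Arguments optimal_coupling {R} X Y _.

Definition homomorphic (R : realType) (X Y : gmspace R) := GW X Y = 0%E.

(* Homomorphism classes, as predicates on gm-spaces: the universe of gmspace R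
   is too large for it to be an argument of set. *)
Record gmclass (R : realType) := GMClass {
  gm_class :> gmspace R -> Prop ;
  gm_classP : exists X, gm_class = homomorphic X }.

Definition class_of (R : realType) (X : gmspace R) : gmclass R :=
  GMClass (ex_intro (fun X' => homomorphic X = homomorphic X') X erefl).

Definition gm_repr (R : realType) (A : gmclass R) : gmspace R :=
  sval (cid (gm_classP A)).

(* GW on classes, through a chosen representative of each class; the choice is
   immaterial by the triangle inequality for GW. *)
Definition GW_class (R : realType) (A B : gmclass R) : \bar R :=
  GW (gm_repr A) (gm_repr B).

(* The simplex Delta_(N-1). *)
Definition simplex (R : realType) (N : nat) (rho : 'I_N -> R) :=
  (forall i, 0 <= rho i <= 1) /\ \sum_i rho i = 1.

Definition mean_gauge (R : realType) (N : nat) (rho : 'I_N -> R)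
    (X : 'I_N -> gauged R) (z : xprod X * xprod X) : R :=
  \sum_i rho i * gm_gauge (X i) (z.1 i, z.2 i).

Definition gluing (R : realType) (N : nat) (Y : gauged R) (X : 'I_N -> gauged R)
    (p : forall i, probability (borel (Y * X i)%type) R) :
    set (probability (borel (Y * xprod X)%type) R) :=
  [set gam | forall i,
     is_pushforward gam (fun z : Y * xprod X => (z.1, z.2 i)) (p i)].

Definition melting (R : realType) (N : nat) (Y : gauged R) (X : 'I_N -> gauged R)
    (p : forall i, probability (borel (Y * X i)%type) R) :
    set (probability (borel (xprod X)) R) :=
  [set mu | exists2 gam, gluing p gam & is_pushforward gam snd mu].

Definition optimal_melting (R : realType) (N : nat) (Y : gauged R)
    (X : 'I_N -> gauged R) : set (probability (borel (xprod X)) R) :=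
  [set mu | exists2 p : forall i, probability (borel (Y * X i)%type) R,
     (forall i, optimal_coupling Y (X i) (p i)) & melting p mu].
Arguments optimal_melting {R N} Y X _.

Definition melting_data (R : realType) (N : nat) (rho : 'I_N -> R)
    (X : 'I_N -> gauged R) (mu : probability (borel (xprod X)) R) : gauged R :=
  @Gauged R (xprod X) (mean_gauge rho (X := X)) mu.

Section polish_prod.
Variables (R : realType) (N : nat) (X : 'I_N -> ptopologicalType).

Lemma xprod_cvg (F : set_system (xprod X)) (x : xprod X) : Filter F ->
  (forall i (A : set (X i)), nbhs (x i) A -> F [set y | A (y i)]) -> F --> x.
Proof.
move=> FF h; apply/cvg_sup => i A /= [_ [[B oB <-] Bx sBA]].
rewrite nbhs_filterE; apply: filterS sBA _; apply: h.
by apply: open_nbhs_nbhs.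
Qed.

Lemma xprod_proj_continuous (i : 'I_N) : continuous (fun f : xprod X => f i).
Proof. exact: (@proj_continuous _ X i). Qed.

Lemma separable_seq (T : ptopologicalType) : separable_space T ->
  exists s : nat -> T, forall A, A !=set0 -> open A -> exists n, A (s n).
Proof.
move=> [S cS dS]; have [f sf] := pcard_surjP cS.
exists f => A A0 oA; have [x [Ax Sx]] := dS A A0 oA.
by have [n _ fn] := sf x Sx; exists n; rewrite fn.
Qed.

Lemma polish_xprod : (forall i, polish R (X i)) -> polish R (xprod X).
Proof.
move=> pX.
have cm i : completely_metrizable R (X i) by case: (pX i).
have [d dP] := all_sig (fun i => cid (cm i)).
have dxx i x : d i x x = 0.
  by case: (dP i) => -[d0 _ _] _ _; apply: (d0 x x).2.
have dC i x y : d i x y = d i y x.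
  by case: (dP i) => -[_ h _] _ _; apply: h.
have dT i x y z : d i x z <= d i x y + d i y z.
  by case: (dP i) => -[_ _ h] _ _; apply: h.
have d_ge0 i x y : 0 <= d i x y.
  have := dT i x y x; rewrite dxx (dC i y x) -mulr2n.
  by rewrite pmulrn_lge0.
pose D (x y : xprod X) := \sum_i d i (x i) (y i).
have dD i x y : d i (x i) (y i) <= D x y.
  by rewrite /D (bigD1 i)//= lerDl sumr_ge0.
have nbD (x : xprod X) (A : set (xprod X)) :
    nbhs x A <-> exists2 e, 0 < e & [set y | D x y < e] `<=` A.
  split.
    pose F := filter_from [set e : R | 0 < e] (fun e => [set y | D x y < e]).
    have FF : Filter F.
      apply: filter_from_filter; first by exists 1 => /=.
      move=> i j /= i0 j0; exists (Num.min i j); first by rewrite /= lt_min i0.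
      by move=> y /=; rewrite lt_min => /andP[].
    have : F --> x.
      apply: xprod_cvg => i B; case: (dP i) => _ nb _.
      move=> /nb [e e0 eB]; exists e => // y /= Dy; apply: eB => /=.
      exact: le_lt_trans (dD i x y) Dy.
    by move=> /[apply] -[e ? ?]; exists e.
  move=> [e e0 eA].
  have e'0 : 0 < e / N.+1%:R by rewrite divr_gt0.
  have : \forall y \near x, forall i : 'I_N, d i (x i) ((y : xprod X) i) < e / N.+1%:R.
    apply: (@filter_forall _ _
      (fun i => [set y : xprod X | d i (x i) (y i) < e / N.+1%:R])
      (nbhs x) (nbhs_filter x)) => i.
    have : nbhs (x i) [set z | d i (x i) z < e / N.+1%:R].
      by case: (dP i) => _ nb _; apply/nb; exists (e / N.+1%:R).
    exact: (@xprod_proj_continuous i x).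
  apply: filterS => y /= h; apply: eA => /=.
  rewrite /D (@le_lt_trans _ _ (\sum_(i < N) e / N.+1%:R))//.
    by apply: ler_sum => i _; apply/ltW/h.
  rewrite sumr_const card_ord -[ltLHS]mulr_natr -mulrA gtr_pMr// mulrC ltr_pdivrMr//.
  by rewrite mul1r ltr_nat.
split.
  have /= sP i := separable_seq (pX i).1.
  pose s i := sval (cid (sP i)).
  have sP' i := svalP (cid (sP i)).
  exists (range (fun k : {ffun 'I_N -> nat} => (fun i => s i (k i)) : xprod X)).
    apply: (card_le_trans (card_image_le _ _)); exact: countableP.
  move=> O [x Ox] oO.
  have /nbD [e e0 eO] : nbhs x O by apply: open_nbhs_nbhs.
  have e'0 : 0 < e / N.+1%:R by rewrite divr_gt0.
  have kP i : exists n, d i (x i) (s i n) < e / N.+1%:R.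
    have nb : nbhs (x i) [set y | d i (x i) y < e / N.+1%:R].
      by case: (dP i) => _ nb _; apply/nb; exists (e / N.+1%:R).
    move: nb; rewrite nbhsE => -[U [oU Ux] sU].
    have [n Un] := sP' i U (ex_intro _ _ Ux) oU.
    by exists n; apply: sU.
  have [k hk] := choice kP.
  exists (fun i => s i (k i)); split.
    apply: eO => /=.
    rewrite /D (@le_lt_trans _ _ (\sum_(i < N) e / N.+1%:R))//.
      by apply: ler_sum => i _; apply/ltW/hk.
    rewrite sumr_const card_ord -[ltLHS]mulr_natr -mulrA gtr_pMr// mulrC ltr_pdivrMr//.
    by rewrite mul1r ltr_nat.
  by exists [ffun i => k i] => //; apply: functional_extensionality_dep => i; rewrite ffunE.
exists D; split => //.
- split.
  + move=> x y; split => [D0|->]; last by rewrite /D big1.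
    apply: functional_extensionality_dep => i.
    case: (dP i) => -[d0 _ _] _ _; apply: (d0 _ _).1; apply/eqP.
    by rewrite eq_le d_ge0 andbT -D0 dD.
  + by move=> x y; apply: eq_bigr => i _.
  + by move=> x y z; rewrite /D -big_split/=; apply: ler_sum => i _.
- move=> u cu.
  have lP i : exists l : X i, (fun n => u n i) @ \oo --> l.
    case: (dP i) => _ _; apply => e e0; have [n0 h] := cu e e0.
    by exists n0 => m n m0 n0'; apply: le_lt_trans (h m n m0 n0').
  have lP' i := svalP (cid (lP i)).
  exists (fun i => sval (cid (lP i))).
  by apply: xprod_cvg => i A /lP'.
Qed.
End polish_prod.

Section melt.
Variable R : realType.
Implicit Types T U V : ptopologicalType.

Lemma continuous_borel T U (f : T -> U) : continuous f ->
  measurable_fun setT (f : borel T -> borel U).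
Proof.
move=> /continuousP cf; 
apply: (@measurability _ _ (borel T) (borel U) setT f (@open U) erefl).
by move=> _ [B oB <-]; rewrite setTI; apply: sub_sigma_algebra; exact: cf.
Qed.

Lemma is_pushforward_comp T U V (f : T -> U) (g : U -> V) m m' m'' :
  continuous f -> continuous g ->
  is_pushforward m f m' -> is_pushforward m' g m'' ->
  @is_pushforward R _ _ m (g \o f) m''.
Proof.
move=> cf cg fP gP A mA; rewrite -gP// /pushforward -fP//.
by rewrite -[X in measurable X]setTI; exact: (continuous_borel cg).
Qed.

Lemma is_pushforward_uncomp T U V (f : T -> U) (g : U -> V) m m' m'' :
  continuous f -> continuous g ->
  is_pushforward m f m' -> @is_pushforward R _ _ m (g \o f) m'' ->
  is_pushforward m' g m''.
Proof.
move=> cf cg fP gP A mA; rewrite -gP// /pushforward -fP//.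
by rewrite -[X in measurable X]setTI; exact: (continuous_borel cg).
Qed.

Section square.
Variables (T U : ptopologicalType) (f : T -> U) (cf : continuous f).
Variables (m : probability (borel T) R) (m' : probability (borel U) R).
Hypothesis fP : is_pushforward m f m'.
Let f2 (z : borel T * borel T) : borel U * borel U := (f z.1, f z.2).

Lemma measurable_square : measurable_fun setT f2.
Proof.
apply/measurable_fun_pairP; split.
  by apply: (measurableT_comp (continuous_borel cf)).
by apply: (measurableT_comp (continuous_borel cf)).
Qed.
#[local] HB.instance Definition _ := @isMeasurableFun.Build _ _ _ _ f2 measurable_square.

Lemma square_pushforward (A : set (borel U * borel U)) : measurable A ->
  (m' \x m')%E A = pushforward (m \x m)%E f2 A.
Proof.
move=> mA.
apply: product_measure_unique => //.
have mpre (C : set (borel U)) : measurable C ->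
    measurable (f @^-1` C : set (borel T)).
  by move=> mC; rewrite -[X in measurable X]setTI; exact: (continuous_borel cf).
move=> C D mC mD; change ((m \x m)%E ((f @^-1` C) `*` (f @^-1` D)) = (m' C * m' D)%E).
rewrite product_measure1E ?fP//=; [|exact: mpre|exact: mpre].
by rewrite -(fP mC) -(fP mD).
Qed.

Lemma Lfun_square (g : borel U * borel U -> R) :
  g \in Lfun (m' \x m')%E 2%:E -> g \o f2 \in Lfun (m \x m)%E 2%:E.
Proof.
rewrite !inE => /andP[]; rewrite !inE /= => mg; rewrite /finite_norm => ng.
apply/andP; rewrite !inE; split => /=.
  exact: (measurableT_comp mg measurable_square).
rewrite /finite_norm; move: ng; rewrite unlock.
pose h : borel U * borel U -> \bar R := EFin \o (fun x => `|g x| `^ 2).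
change ((\int[(m' \x m')%E]_x h x) `^ 2^-1 < +oo -> (\int[(m \x m)%E]_x (h \o f2) x) `^ 2^-1 < +oo)%E.
have mh : measurable_fun [set: borel U * borel U] h.
  apply/measurable_EFinP.
  apply: (measurableT_comp (measurable_powR _)) => //.
  exact: measurableT_comp.
rewrite (eq_measure_integral (pushforward (m \x m)%E f2)); last first.
  by move=> A mA _; apply: square_pushforward.
rewrite (ge0_integral_pushforward measurable_square)//.
by move=> x _; rewrite lee_fin powR_ge0.

Qed.

Lemma ae_square (Q : borel U * borel U -> Prop) :
  {ae (m' \x m')%E, forall z, Q z} -> {ae (m \x m)%E, forall z, Q (f2 z)}.
Proof.
move=> [A [mA A0 QA]]; exists (f2 @^-1` A); split.
- by rewrite -[X in measurable X]setTI; exact: measurable_square.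
- by have := square_pushforward mA; rewrite /pushforward => <-.
- by move=> z /= h; apply: QA.
Qed.
End square.

Lemma melting_marginal (N : nat) (Y : gauged R) (X : 'I_N -> gauged R) mu i :
  optimal_melting Y X mu ->
  is_pushforward mu (fun x : xprod X => x i) (gm_meas (X i)).
Proof.
move=> [p po [gam gP muP]].
have [[_ pX] _] := po i.
have cs (T U : ptopologicalType) : continuous (snd : T * U -> U).
  by move=> z; exact: cvg_snd.
have ci : continuous (fun x : xprod X => x i) by exact: xprod_proj_continuous.
apply: (is_pushforward_uncomp (cs _ _) ci muP).
have cg : continuous (fun z : Y * xprod X => (z.1, z.2 i)).
  move=> z; apply: cvg_pair => /=; first exact: cvg_fst.
  by apply: (@continuous_comp _ _ _ snd (fun x : xprod X => x i)); [exact: cs|exact: ci].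
exact: (is_pushforward_comp cg (cs _ _) (gP i) pX).
Qed.

Lemma melting_data_gm (N : nat) (rho : 'I_N -> R) (Y : gauged R)
    (X : 'I_N -> gmspace R) mu :
  optimal_melting Y X mu -> is_gm (melting_data rho mu).
Proof.
move=> om; pose mX i := melting_marginal (i := i) om.
have ci i : continuous (fun x : xprod X => x i) by exact: xprod_proj_continuous.
split => /=.
- by apply: polish_xprod => i; have [] := gm_axiom (X i).
- rewrite (_ : mean_gauge rho (X:=X) = \sum_i rho i *: (fun z : xprod X * xprod X => gm_gauge (X i) (z.1 i, z.2 i))); last first.
    by apply/funext => z; rewrite fct_sumE.
  have le12 : (1 <= 2%:E :> \bar R)%E by rewrite lee_fin ler1n.
  have [L0 Ladd] := Lfun_addr_closed (mu \x mu)%E le12.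
  have [_ Lz] := Lfun_submod_closed (mu \x mu)%E le12.
  elim/big_ind : _ => // i _.
  rewrite -[X in X \in _]addr0; apply: Lz => //.
  by apply: (Lfun_square (ci i) (mX i)); have [] := gm_axiom (X i).
- have FF := ae_filter_ringOfSetsType (mu \x mu)%E.
  have := @filter_forall _ _ (fun i => [set z : xprod X * xprod X |
    gm_gauge (X i) (z.1 i, z.2 i) = gm_gauge (X i) (z.2 i, z.1 i)]) _ FF.
  move=> /(_ _)/filterS; apply.
    by move=> z /= h; apply: eq_bigr => i _; rewrite h.
  move=> i; have [_ _ sX] := gm_axiom (X i).
  exact: (@ae_square _ _ _ (ci i) mu _ (mX i)
    (fun z => gm_gauge (X i) z = gm_gauge (X i) (z.2, z.1))).
Qed.
End melt.

Definition melting_space (R : realType) (N : nat) (rho : 'I_N -> R) (Y : gauged R)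
    (X : 'I_N -> gmspace R) (mu : probability (borel (xprod X)) R)
    (omu : optimal_melting Y X mu) : gmspace R :=
  GMSpace (melting_data_gm rho omu).

(* Neither the representative of Y nor those of the X i matter, so all of them
   are allowed here. *)
Definition TB (R : realType) (N : nat) (rho : 'I_N -> R) (X : 'I_N -> gmclass R)
    (Y Z : gmclass R) : Prop :=
  exists (X0 : 'I_N -> gmspace R) (Y0 : gmspace R)
    (mu : probability (borel (xprod X0)) R) (omu : optimal_melting Y0 X0 mu),
    [/\ forall i, X i (X0 i), Y Y0 & Z = class_of (melting_space rho omu)].

Definition bary_functional (R : realType) (N : nat) (rho : 'I_N -> R)
    (X : 'I_N -> gmclass R) (W : gmclass R) : \bar R :=
  (\sum_(i < N) (rho i)%:E * GW_class (X i) W ^+ 2)%E.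

Definition barycenter (R : realType) (N : nat) (rho : 'I_N -> R)
    (X : 'I_N -> gmclass R) (Y : gmclass R) : Prop :=
  forall W, (bary_functional rho X Y <= bary_functional rho X W)%E.

(* Main.v *)
(* Integrating over a gluing of the optimal plans, the variance identity
     sum_i rho_i (h - g_i)^2 = sum_i rho_i (g_i - m)^2 + (h - m)^2,
   with m = sum_j rho_j g_j, turns the left side into F_rho(Y), while the terms
   on the right are the costs of (in general non-optimal) plans between X_i and
   Z and between Y and Z.

   Passing between representatives of a class needs the triangle inequality for
   GW. It is obtained without disintegration: the gauge of the middle space is
   approximated in L^2 by functions constant on the cells of a product partition,
   and the two plans are glued along that countable partition only. *)
From HB Require Import structures.
Require Import Defs.
From mathcomp Require Import all_boot all_order all_algebra.
From mathcomp Require Import all_classical all_reals all_analysis.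
From mathcomp Require Import measurable_realfun.
From mathcomp Require Import ring.

Set Implicit Arguments.
Unset Strict Implicit.
Unset Printing Implicit Defensive.

Import Order.TTheory GRing.Theory Num.Theory.
Import numFieldNormedType.Exports.

Local Open Scope classical_set_scope.
Local Open Scope ring_scope.

(** * Extended-real L^2 norms *)

Section L2norm.
Context d (T : measurableType d) (R : realType) (m : {measure set T -> \bar R}).
Implicit Types f g : T -> R.

Definition L2norm f : \bar R := sqrte (\int[m]_x (f x ^+ 2)%:E)%E.

Lemma L2norm_ge0 f : (0 <= L2norm f)%E.
Proof. exact: sqrte_ge0. Qed.

Lemma measurable_sqr f : measurable_fun setT f ->
  measurable_fun setT (fun x => (f x ^+ 2)%:E).
Proof. by move=> mf; apply/measurable_EFinP; exact: measurable_funX. Qed.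

Lemma integral_sqr_ge0 f : (0 <= \int[m]_x (f x ^+ 2)%:E)%E.
Proof. by apply: integral_ge0 => x _; rewrite lee_fin sqr_ge0. Qed.

Lemma L2norm_sqr f : (L2norm f ^+ 2 = \int[m]_x (f x ^+ 2)%:E)%E.
Proof. by rewrite sqr_sqrte// integral_sqr_ge0. Qed.

(** The bridge to the general ['N[m]_2] norm, through which [L2normD] inherits Minkowski's
    inequality. *)
Lemma L2normE f : L2norm f = ('N[m]_2%:E [EFin \o f])%E.
Proof.
rewrite unlock /L2norm -poweR12_sqrt ?integral_sqr_ge0//; congr (_ `^ _)%E.
apply: eq_integral => x _ /=.
by rewrite powR_mulrn// real_normK// num_real.
Qed.

Lemma L2normD f g : measurable_fun setT f -> measurable_fun setT g ->
  (L2norm (f \+ g)%R <= L2norm f + L2norm g)%E.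
Proof.
by move=> mf mg; rewrite !L2normE; apply: minkowski_EFin => //; rewrite ler1n.
Qed.

Lemma L2normN f : L2norm (fun x => - f x) = L2norm f.
Proof. by congr sqrte; apply: eq_integral => x _; rewrite sqrrN. Qed.

Lemma ae_eq_L2norm f g : measurable_fun setT f -> measurable_fun setT g ->
  {ae m, forall x, f x = g x} -> L2norm f = L2norm g.
Proof.
move=> mf mg fg; congr sqrte; apply: ge0_ae_eq_integral => //.
- exact: measurable_sqr.
- exact: measurable_sqr.
- by move=> x _; rewrite lee_fin sqr_ge0.
- by move=> x _; rewrite lee_fin sqr_ge0.
- by apply: filterS fg => x /= -> _.
Qed.

(** Pointwise, 2a^2 + 2b^2 - (a + b)^2 = (a - b)^2. This serves as a triangle inequality wherever
    errors are measured by integrals of squares. *)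
Lemma integral_sqrD_le f g : measurable_fun setT f -> measurable_fun setT g ->
  (\int[m]_x ((f x + g x) ^+ 2)%R%:E <=
   2%:E * \int[m]_x (f x ^+ 2)%:E + 2%:E * \int[m]_x (g x ^+ 2)%:E)%E.
Proof.
move=> mf mg.
rewrite -!ge0_integralZl//; try exact: measurable_sqr;
  try by move=> *; rewrite lee_fin sqr_ge0.
rewrite -ge0_integralD//.
- apply: ge0_le_integral => //.
  + by move=> *; rewrite lee_fin sqr_ge0.
  + by apply: measurable_sqr; exact: measurable_funD.
  + by apply: emeasurable_funD; apply: measurable_funeM; exact: measurable_sqr.
  + move=> x _; rewrite -!EFinM -EFinD lee_fin.
    by rewrite -subr_ge0 (_ : _ - _ = (f x - g x) ^+ 2) ?sqr_ge0//; ring.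
- by move=> x _; rewrite mule_ge0// lee_fin sqr_ge0.
- by apply: measurable_funeM; exact: measurable_sqr.
- by move=> x _; rewrite mule_ge0// lee_fin sqr_ge0.
- by apply: measurable_funeM; exact: measurable_sqr.
Qed.

End L2norm.

(** * Change of variables for image measures and their squares *)

Section law.
Context d d' (T : measurableType d) (U : measurableType d') (R : realType).
Variables (mu : probability T R) (nu : probability U R) (f : T -> U).
Hypotheses (mf : measurable_fun setT f)
  (fP : forall A, measurable A -> mu (f @^-1` A) = nu A).

Lemma ge0_integral_law (h : U -> \bar R) : measurable_fun setT h ->
  (forall y, (0 <= h y)%E) -> (\int[nu]_y h y = \int[mu]_x h (f x))%E.
Proof.
move=> mh h0.
pose F : {mfun T >-> U} := HB.pack f (isMeasurableFun.Build _ _ _ _ _ mf).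
rewrite (eq_measure_integral (pushforward mu F)); last first.
  by move=> A mA _; exact/esym/fP.
by rewrite (ge0_integral_pushforward mf).
Qed.

End law.

Section law_square.
Context d d' (T : measurableType d) (U : measurableType d') (R : realType).
Variables (mu : probability T R) (nu : probability U R) (f : T -> U).
Hypotheses (mf : measurable_fun setT f)
  (fP : forall A, measurable A -> mu (f @^-1` A) = nu A).

Let f2 (z : T * T) : U * U := (f z.1, f z.2).

Lemma measurable_pair_square : measurable_fun setT f2.
Proof.
by apply/measurable_fun_pairP; split; exact: (measurableT_comp mf).
Qed.

(** The image of [mu \x mu] agrees with [nu \x nu] on rectangles, and these determine the product
    measure. *)
Lemma law_square A : measurable A -> (mu \x mu)%E (f2 @^-1` A) = (nu \x nu)%E A.
Proof.
move=> mA.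
pose F : {mfun (T * T)%type >-> (U * U)%type} :=
  HB.pack f2 (isMeasurableFun.Build _ _ _ _ _ measurable_pair_square).
rewrite (product_measure_unique (m' := pushforward (mu \x mu)%E F))//.
move=> C D mC mD.
change ((mu \x mu)%E ((f @^-1` C) `*` (f @^-1` D)) = (nu C * nu D)%E).
have mpre E : measurable E -> measurable (f @^-1` E).
  by move=> mE; rewrite -[X in measurable X]setTI; exact: mf.
rewrite product_measure1E; [by congr (_ * _)%E; exact: fP|exact: mpre|exact: mpre].
Qed.

Lemma L2norm_law (h : U * U -> R) : measurable_fun setT h ->
  L2norm (nu \x nu)%E h = L2norm (mu \x mu)%E (h \o f2).
Proof.
move=> mh; congr sqrte.
apply: (ge0_integral_law measurable_pair_square law_square).
  exact: measurable_sqr.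
by move=> y; rewrite lee_fin sqr_ge0.
Qed.

End law_square.

(** * Closure properties of block approximation *)

Section block_approx.
Context d (T : measurableType d) (R : realType) (m : probability T R).
Implicit Types (f g : T * T -> R) (c : T -> nat) (s : nat * nat -> R).

(* s (c x, c y) is constant on the products of the blocks c = k, hence it is
   unchanged when x is replaced by another point of its block. *)
Definition block_approx f := measurable_fun setT f /\
  forall e : R, 0 < e -> exists c s, (forall k, measurable (c @^-1` [set k])) /\
    (\int[m \x m]_z ((f z - s (c z.1, c z.2)) ^+ 2)%R%:E <= e%:E)%E.

(** Every preimage is a countable union of products of two blocks, whatever the values [s]. *)
Lemma measurable_block c s : (forall k, measurable (c @^-1` [set k])) ->
  measurable_fun setT (fun z : T * T => s (c z.1, c z.2)).
Proof.
move=> mc _ B mB; rewrite setTI.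
rewrite (_ : _ @^-1` _ = \bigcup_(k : nat * nat)
    (if s k \in B then (c @^-1` [set k.1]) `*` (c @^-1` [set k.2]) else set0)).
  apply: countable_bigcupT_measurable => // k.
  by case: ifPn => // _; exact: measurableX.
apply/seteqP; split => [z /= Bz|z [[i j] _]].
  by exists (c z.1, c z.2) => //; rewrite mem_set.
by case: ifPn => // /set_mem Bk [/= -> ->].
Qed.

Lemma block_approx_lim f : measurable_fun setT f ->
  (forall e : R, 0 < e -> exists2 g, block_approx g &
    (\int[m \x m]_z ((f z - g z) ^+ 2)%R%:E <= e%:E)%E) -> block_approx f.
Proof.
(* Two errors of e / 4 combine to 2(e / 4) + 2(e / 4) = e by [integral_sqrD_le]. *)
move=> mf h; split => // e e0; have e4 : 0 < e / 4 by rewrite divr_gt0.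
have [g [mg /(_ _ e4) [c [s [mc gs]]]] fg] := h _ e4.
exists c, s; split => //.
under eq_integral => z _ do rewrite -[X in X ^+ 2](subrKA (g z)).
apply: le_trans.
  apply: (@integral_sqrD_le _ _ _ (m \x m)%E (fun z => f z - g z)
    (fun z => g z - s (c z.1, c z.2))).
  - exact: measurable_funB.
  - by apply: measurable_funB => //; exact: (measurable_block s mc).
rewrite (_ : e%:E = 2%:E * (e / 4)%:E + 2%:E * (e / 4)%:E)%E.
  by rewrite leeD// lee_pmul2l.
by rewrite -!EFinM -EFinD; congr EFin; field.
Qed.

(** Both block functions are constant on products of blocks of the common refinement, whose blocks
    are indexed by the code of the pair [(c x, c' x)]. *)
Lemma block_approxD f g :
  block_approx f -> block_approx g -> block_approx (f \+ g).
Proof.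
move=> [mf af] [mg ag]; split; first exact: measurable_funD.
move=> e e0; have e4 : 0 < e / 4 by rewrite divr_gt0.
have [c [s [mc fs]]] := af _ e4; have [c' [s' [mc' gs]]] := ag _ e4.
(* The default pair is returned only at numbers coding no pair, which [C] never takes. *)
pose un k : nat * nat := odflt (0, 0)%N (unpickle k).
pose C x := pickle (c x, c' x).
pose S (k : nat * nat) :=
  s ((un k.1).1, (un k.2).1) + s' ((un k.1).2, (un k.2).2).
exists C, S; split.
  move=> k; case ek : (unpickle k : option (nat * nat)) => [[i j]|].
    rewrite (_ : _ @^-1` _ = if pickle (i, j) == k then
        (c @^-1` [set i]) `&` (c' @^-1` [set j]) else set0).
      by case: ifP => // _; exact: measurableI.
    apply/seteqP; split => x /=.
      move=> Ck; have := ek; rewrite -Ck pickleK => -[<- <-].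
      by rewrite eqxx.
    by case: eqP => // <- -[/= <- <-].
  rewrite (_ : _ @^-1` _ = set0)//; apply/seteqP; split => x //= Ck.
  by move: ek; rewrite -Ck pickleK.
have SE z : S (C z.1, C z.2) = s (c z.1, c z.2) + s' (c' z.1, c' z.2).
  by rewrite /S /un /= !pickleK.
under eq_integral => z _ do rewrite SE /= opprD addrACA.
apply: le_trans.
  apply: (@integral_sqrD_le _ _ _ (m \x m)%E (fun z => f z - s (c z.1, c z.2))
    (fun z => g z - s' (c' z.1, c' z.2))).
  - by apply: measurable_funB => //; exact: (measurable_block s mc).
  - by apply: measurable_funB => //; exact: (measurable_block s' mc').
rewrite (_ : e%:E = 2%:E * (e / 4)%:E + 2%:E * (e / 4)%:E)%E.
  by rewrite leeD// lee_pmul2l.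
by rewrite -!EFinM -EFinD; congr EFin; field.
Qed.

Lemma block_approxZ (a : R) f : block_approx f -> block_approx (fun z => a * f z).
Proof.
move=> [mf af]; split; first exact: measurable_funM.
(* Dividing by a^2 + 1 rather than a^2 covers a = 0 as well. *)
move=> e e0; have a0 : 0 < a ^+ 2 + 1 by rewrite ltr_wpDl ?sqr_ge0.
have [c [s [mc fs]]] := af (e / (a ^+ 2 + 1)) (divr_gt0 e0 a0).
exists c, (fun k => a * s k); split => //.
under eq_integral => z _ do rewrite -mulrBr exprMn EFinM.
rewrite ge0_integralZl ?lee_fin ?sqr_ge0//=; last 2 first.
- by apply: measurable_sqr; apply: measurable_funB => //; exact: (measurable_block s mc).
- by move=> *; rewrite lee_fin sqr_ge0.
apply: (@le_trans _ _ ((a ^+ 2)%:E * (e / (a ^+ 2 + 1))%:E)%E).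
  by apply: lee_pmul => //; rewrite ?lee_fin ?sqr_ge0// integral_sqr_ge0.
rewrite -EFinM lee_fin mulrA ler_pdivrMr// [leRHS]mulrC.
by rewrite ler_wpM2r ?lerDl// ltW.
Qed.

Lemma block_approx_cst (a : R) : block_approx (cst a).
Proof.
split => // e e0; exists (fun=> 0%N), (fun=> a); split => [k|].
  by rewrite preimage_cst; case: ifP.
by rewrite integral0_eq ?lee_fin ?ltW// => z _; rewrite subrr expr0n.
Qed.

Lemma block_approx_sum (I : Type) (r : seq I) (F : I -> T * T -> R) :
  (forall i, block_approx (F i)) -> block_approx (fun z => \sum_(i <- r) F i z).
Proof.
move=> aF; elim: r => [|i r IH].
  by under [X in block_approx X]funext => z do rewrite big_nil; exact: block_approx_cst.
under [X in block_approx X]funext => z do rewrite big_cons.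
exact: block_approxD.
Qed.

(** The indicator is itself a block function for the partition generated by [A] and [B], so the
    error is zero. *)
Lemma block_approx_rectangle (A B : set T) : measurable A -> measurable B ->
  block_approx \1_(A `*` B).
Proof.
move=> mA mB; split; first by apply: measurable_indic; exact: measurableX.
move=> e e0.
(* The low bit of the block number records membership in [A], the high bit membership in [B]; block
   numbers are at most 3, so [1 < k.2] reads the high bit. *)
exists (fun x => (x \in A) + (x \in B).*2)%N, (fun k => (odd k.1 && (1 < k.2)%N)%:R).
split => [k|].
  rewrite (_ : _ @^-1` _ =
    (if odd k then A else ~` A) `&`
    (if k./2 == 0 then ~` B else if k./2 == 1 then B else set0)%N).
    apply: measurableI; first by case: ifP => // _; exact: measurableC.
    by case: ifP => _; [exact: measurableC|case: ifP].
  apply/seteqP; split => x /=.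
    move=> <-; rewrite oddD odd_double addbF oddb half_bit_double.
    split; first by case: ifPn => [/set_mem//|/negP]; rewrite inE.
    by case: (boolP (x \in B)) => /= [/set_mem//|/negP]; rewrite inE.
  move=> [hA hB]; rewrite -[RHS]odd_double_half; congr (_ + _.*2)%N.
    case: (odd k) hA => hA; first by rewrite mem_set.
    by apply/eqP; rewrite eqb0; apply/negP; rewrite inE.
  move: hB; case: eqP => [-> hB|_].
    by apply/eqP; rewrite eqb0; apply/negP; rewrite inE.
  by case: eqP => // -> hB; rewrite mem_set.
rewrite integral0_eq ?lee_fin ?ltW// => -[x y] _ /=.
rewrite oddD odd_double addbF oddb indicE in_setX/=.
suff -> : (1 < (y \in A) + (y \in B).*2)%N = (y \in B) by rewrite subrr expr0n.
by case: (y \in A); case: (y \in B).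
Qed.
End block_approx.

(** * Density of block functions in L^2 *)

Section block_approx_L2.
Context d (T : measurableType d) (R : realType) (m : probability T R).

(** Dynkin's theorem: rectangles are stable under intersection and generate the product
    sigma-algebra, and the approximable sets are closed under complements and countable disjoint
    unions. *)
Lemma block_approx_indic (A : set (T * T)) : measurable A ->
  block_approx m \1_A.
Proof.
move=> mA; have : <<s [set B `*` C | B in d.-measurable & C in d.-measurable] >> A.
  by rewrite -measurable_prod_measurableType.
apply: (dynkin_induction (P := fun A => block_approx m \1_A)
  (measurable_prod_measurableType T T)).
- move=> _ _ [B mB [C mC <-]] [B' mB' [C' mC' <-]].
  by exists (B `&` B'); [exact: measurableI|exists (C `&` C');
    [exact: measurableI|rewrite setXI]].
- by rewrite indicT; exact: block_approx_cst.
- by move=> _ [B mB [C mC <-]]; exact: block_approx_rectangle.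
- move=> S mS aS; rewrite (_ : \1_(~` S) = cst 1 \+ (fun z => -1 * \1_S z)).
    by apply: block_approxD; [exact: block_approx_cst|exact: block_approxZ].
  apply/funext => z /=; rewrite !indicE in_setC.
  by case: (z \in S) => /=; rewrite ?mulr1 ?mulr0 ?addr0// subrr.
move=> F mF tF aF.
have mU n : measurable (\bigcup_(i < n) F i) by exact: bigcup_measurable.
have mUF : measurable (\bigcup_i F i) by exact: bigcupT_measurable.
have aU n : block_approx m \1_(\bigcup_(i < n) F i).
  elim: n => [|n IH].
    by rewrite bigcup_mkord big_ord0 indic0; exact: block_approx_cst.
  rewrite (_ : \1_ _ = \1_(\bigcup_(i < n) F i) \+ \1_(F n)); first exact: block_approxD.
  apply/funext => z; rewrite /= bigcup_mkord big_ord_recr/= -bigcup_mkord.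
  rewrite !indicE in_setU.
  case: (boolP (z \in F n)) => [/set_mem Fz|_]; last by rewrite orbF addr0.
  case: (boolP (z \in _)) => [/set_mem [i /= ni Fiz]|]; last by rewrite add0r.
  have /seteqP[/(_ z) + _] := (trivIsetP.1 tF) i n I I (negbT (ltn_eqF ni)).
  by case.
apply: block_approx_lim => [|e e0]; first exact: measurable_indic.
(* The squared error of the n-th partial union is the indicator of [G n]; these sets decrease to the
   empty set, so their measure tends to 0. *)
pose G n := \bigcup_i F i `\` \bigcup_(i < n) F i.
have mG n : measurable (G n) by exact: measurableD.
have G0 : \bigcap_n G n = set0.
  rewrite -subset0 => z Gz; have [[i _ Fz] _] := Gz 0%N I.
  by have [_] := Gz i.+1 I; apply; exists i => //=.
have fG n : (m \x m)%E (G n) \is a fin_num.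
  by rewrite ge0_fin_numE// (le_lt_trans (probability_le1 _ (mG n))) ?ltry.
have : ((m \x m)%E \o G) n @[n --> \oo] --> (0 : \bar R)%E.
  rewrite -(measure0 (m \x m)%E) -G0; apply: nonincreasing_cvg_mu => //.
  - by have := fG 0%N; rewrite ge0_fin_numE.
  - by rewrite G0.
  - move=> i j ij; apply/subsetPset => z [Fz nFz]; split => // -[k /= ki Fkz].
    by apply: nFz; exists k => //=; exact: leq_trans ki ij.
move=> /fine_cvgP[_] /cvgrPdist_lt /(_ _ e0) [n _ /(_ n (leqnn n))] /=.
rewrite sub0r normrN => ne.
exists \1_(\bigcup_(i < n) F i) => //.
rewrite (eq_integral (fun z => (\1_(G n) z)%:E)); last first.
  move=> z _; congr EFin; rewrite !indicE in_setD.
  have [/set_mem zU|_] := boolP (z \in \bigcup_(i < n) F i).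
    rewrite andbF mem_set ?subrr ?expr0n//.
    by case: zU => i _ Fz; exists i.
  by rewrite subr0 andbT -natrX; case: (_ \in _).
rewrite integral_indic// setIT.
apply: (@le_trans _ _ (fine ((m \x m)%E (G n)))%:E); first by rewrite fineK.
by rewrite lee_fin ltW// (le_lt_trans (ler_norm _) ne).
Qed.

Import HBNNSimple.

Lemma block_approx_nnsfun (h : {nnsfun (T * T)%type >-> R}) : block_approx m h.
Proof.
rewrite (_ : (h : T * T -> R) = fun z =>
  \sum_(y <- finmap.enum_fset (fset_set (range h))) y * \1_(h @^-1` [set y]) z).
  apply: block_approx_sum => y; apply: block_approxZ.
  exact: block_approx_indic.
by apply/funext => z; rewrite {1}fimfunE fsbig_finite.
Qed.

(** Simple functions a_n increase to f, so (f - a_n)^2 tends to 0 and is dominated by the integrable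
    f^2. *)
Lemma ge0_block_approx_L2 (f : T * T -> R) : measurable_fun setT f ->
  (forall z, 0 <= f z) -> (\int[m \x m]_z (f z ^+ 2)%:E < +oo)%E ->
  block_approx m f.
Proof.
move=> mf f0 fi; apply: block_approx_lim => // e e0.
have mEf : measurable_fun setT (EFin \o f) by exact/measurable_EFinP.
pose a := nnsfun_approx measurableT mEf.
have a_cvg z : a n z @[n --> \oo] --> f z.
  have /fine_cvgP[_] := @cvg_nnsfun_approx _ _ _ _ measurableT _ mEf
    (fun z _ => f0 z) z I.
  by [].
have a_le n z : a n z <= f z.
  rewrite -(cvg_lim (@Rhausdorff R) (a_cvg z)).
  apply: (@nondecreasing_cvgn_le _ (fun n => a n z)).
    by move=> i j ij; exact/lefP/nd_nnsfun_approx.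
  by apply/cvg_ex; exists (f z); exact: a_cvg.
have a_ge0 n z : 0 <= a n z by [].
have mD n : measurable_fun setT (fun z => f z - a n z) by exact: measurable_funB.
have [|||_ _] := @dominated_convergence _ _ _ (m \x m)%E setT measurableT
  (fun n z => ((f z - a n z) ^+ 2)%:E) (cst 0%E) (fun z => (f z ^+ 2)%:E)
  (fun n => measurable_sqr (mD n)) (measurable_cst _).
- apply: aeW => z _; apply: cvg_EFin; first by apply: nearW.
  have c0 : f z - a n z @[n --> \oo] --> 0.
    by rewrite -(subrr (f z)); apply: cvgB; [exact: cvg_cst|exact: a_cvg].
  by rewrite /comp/= -(mulr0 0); exact: (cvgM c0 c0).
- apply/integrableP; split; first exact: measurable_sqr.
  by under eq_integral => z _ do rewrite gee0_abs ?lee_fin ?sqr_ge0//.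
- apply: aeW => z n _; rewrite gee0_abs ?lee_fin ?sqr_ge0//.
  by rewrite ler_sqr ?nnegrE ?subr_ge0 ?f0// gerBl.
rewrite integral0 => /fine_cvgP[[n1 _ fin]] /cvgrPdist_lt /(_ _ e0) [n2 _ dist].
pose n := maxn n1 n2; exists (a n); first exact: block_approx_nnsfun.
have := fin n (leq_maxl _ _); rewrite /= => /fineK <-.
rewrite lee_fin ltW//.
apply: le_lt_trans (dist n (leq_maxr _ _)) => /=.
by rewrite sub0r normrN ler_norm.
Qed.

(** The positive and negative parts are bounded by |f|, hence square integrable, and the nonnegative
    case applies to each. *)
Lemma block_approx_L2 (f : T * T -> R) : measurable_fun setT f ->
  (\int[m \x m]_z (f z ^+ 2)%:E < +oo)%E -> block_approx m f.
Proof.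
move=> mf fi; rewrite -(funrposBneg f).
rewrite (_ : f^\+ - f^\- = f^\+ \+ (fun z => -1 * f^\- z)); last first.
  by apply/funext => z /=; rewrite mulN1r.
have bnd (g : T * T -> R) : measurable_fun setT g -> (forall z, 0 <= g z <= `|f z|) ->
    block_approx m g.
  move=> mg gf; apply: ge0_block_approx_L2 => //.
    by move=> z; case/andP: (gf z).
  apply: le_lt_trans fi; apply: ge0_le_integral => //.
  - by move=> *; rewrite lee_fin sqr_ge0.
  - exact: measurable_sqr.
  - exact: measurable_sqr.
  - move=> z _; case/andP: (gf z) => g0 gfz.
    by rewrite lee_fin -(real_normK (num_real (f z))) ler_sqr ?nnegrE.
have nE z : f^\+ z + f^\- z = `|f z| by have := congr1 (@^~ z) (funrposDneg f).
apply: block_approxD; last apply: block_approxZ; apply: bnd.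
- exact: measurable_funrpos.
- by move=> z; rewrite funrpos_ge0 -nE lerDl funrneg_ge0.
- exact: measurable_funrneg.
- by move=> z; rewrite funrneg_ge0 -nE lerDr funrpos_ge0.
Qed.
End block_approx_L2.

(** * Gluing two probabilities along a countable partition *)

Section discrete_gluing.
Context d d' (A : measurableType d) (B : measurableType d') (R : realType).
Variables (p : probability A R) (q : probability B R) (u : A -> nat) (v : B -> nat).
Hypotheses (mu : forall k, measurable (u @^-1` [set k]))
  (mv : forall k, measurable (v @^-1` [set k]))
  (uv : forall k, p (u @^-1` [set k]) = q (v @^-1` [set k])).

Let D k := (u @^-1` [set k]) `*` (v @^-1` [set k]).
Let mD k : measurable (D k). Proof. exact: measurableX. Qed.
Let w k : R := fine (p (u @^-1` [set k])).
Let w_ge0 k : 0 <= (w k)^-1. Proof. by rewrite invr_ge0 fine_ge0. Qed.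
(* Given u = v = k, the two components are independent. When p (u = k) = 0 the
   weight is 0^-1 = 0, which is harmless: the k-th summand is null anyway. *)
Let gam : set (A * B) -> \bar R :=
  mseries (fun k => mscale (NngNum (w_ge0 k)) (mrestr (p \x q)%E (mD k))) 0.
#[local] HB.instance Definition _ := Measure.on gam.

Let gamE (C : set A) (E : set B) : measurable C -> measurable E ->
  gam (C `*` E) = (\sum_(k <oo) (w k)^-1%:E *
    (p (C `&` u @^-1` [set k]) * q (E `&` v @^-1` [set k])))%E.
Proof.
move=> mC mE; apply: eq_eseriesr => k _.
transitivity ((w k)^-1%:E * (p \x q) ((C `*` E) `&` D k))%E; first by [].
by rewrite /D -setXI product_measure1E//; exact: measurableI.
Qed.

Let pE k : p (u @^-1` [set k]) = (w k)%:E.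
Proof. by rewrite fineK// fin_num_measure. Qed.

Let sum_fibers d0 (S : measurableType d0) (r : probability S R) (t : S -> nat) C :
  (forall k, measurable (t @^-1` [set k])) -> measurable C ->
  (\sum_(k <oo) r (C `&` t @^-1` [set k]) = r C)%E.
Proof.
move=> mt mC; rewrite -measure_semi_bigcup.
- congr (r _); apply/seteqP; split => [x [k _ []]//|x Cx].
  by exists (t x).
- by move=> k; exact: measurableI.
- apply/trivIsetP => i j _ _ /eqP ij; rewrite -subset0 => x /= [[_ ti] [_ tj]].
  by apply: ij; rewrite -ti -tj.
- by apply: bigcupT_measurable => k; exact: measurableI.
Qed.

Let cancel_weight k (x : \bar R) : (0 <= x)%E -> (x <= (w k)%:E)%E ->
  ((w k)^-1%:E * (x * (w k)%:E) = x)%E.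
Proof.
move=> x0 xw; have [w0|w0] := eqVneq (w k) 0.
  by move: xw; rewrite w0 !mule0 => xw; apply/eqP; rewrite eq_le x0; exact: xw.
by rewrite muleCA -EFinM mulVf// mule1.
Qed.

Let gam_fst C : measurable C -> gam (fst @^-1` C) = p C.
Proof.
move=> mC; rewrite (_ : fst @^-1` C = C `*` setT); last first.
  by apply/seteqP; split => // x [].
rewrite gamE// -(sum_fibers p mu mC); apply: eq_eseriesr => k _.
rewrite setTI -uv pE cancel_weight// -pE le_measure// ?inE//; first exact: measurableI.
Qed.

Let gam_snd C : measurable C -> gam (snd @^-1` C) = q C.
Proof.
move=> mC; rewrite (_ : snd @^-1` C = setT `*` C); last first.
  by apply/seteqP; split => // x [].
rewrite gamE// -(sum_fibers q mv mC); apply: eq_eseriesr => k _.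
rewrite setTI pE [X in (_ * X)%E]muleC cancel_weight//.
rewrite -pE uv le_measure// ?inE//; exact: measurableI.
Qed.

Let gamT : gam setT = 1%E.
Proof. by rewrite -(@probability_setT _ _ _ p) -gam_fst. Qed.

#[local] HB.instance Definition _ := Measure_isProbability.Build _ _ _ gam gamT.

(** Since [p] and [q] give the k-th block the same mass, dividing by it once restores both marginals
    of the k-th summand; summing over k then gives [p] and [q]. *)
Lemma discrete_gluing : exists g : probability (A * B)%type R,
  [/\ forall C, measurable C -> g (fst @^-1` C) = p C,
      forall C, measurable C -> g (snd @^-1` C) = q C &
      g.-negligible [set z | u z.1 <> v z.2]].
Proof.
exists (gam : probability _ _); split => //.
(* The complement of this set is the union of the [D k], and each summand of [gam] is carried by its
   [D k]. *)
exists [set z | u z.1 <> v z.2]; split => //.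
  rewrite (_ : mkset _ = ~` \bigcup_k D k).
    by apply: measurableC; exact: bigcupT_measurable.
  apply/seteqP; split => z /= uvz.
    by move=> [k _ [/= uk vk]]; apply: uvz; rewrite uk vk.
  by move=> uvE; apply: uvz; exists (u z.1).
rewrite [LHS]eseries0// => k _ _.
transitivity ((w k)^-1%:E * (p \x q) ([set z | u z.1 <> v z.2] `&` D k))%E; first by [].
rewrite (_ : _ `&` _ = set0) ?measure0 ?mule0//.
by rewrite -subset0 => z [/= uvz [/= uk vk]]; apply: uvz; rewrite uk vk.
Qed.
End discrete_gluing.

(** * Borel measurability of maps into products *)

Lemma continuous_fst (T U : ptopologicalType) : continuous (fst : T * U -> T).
Proof. by move=> z; exact: cvg_fst. Qed.

Lemma continuous_snd (T U : ptopologicalType) : continuous (snd : T * U -> U).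
Proof. by move=> z; exact: cvg_snd. Qed.

Lemma measurable_pairing_borel (T U V : ptopologicalType) (f : T -> U) (g : T -> V) :
  continuous f -> continuous g ->
  measurable_fun setT (fun t : borel T => (f t, g t) : borel (U * V)%type).
Proof.
move=> cf cg; apply: continuous_borel => t.
by apply: cvg_pair; [exact: cf|exact: cg].
Qed.

Lemma measurable_fst_borel (T U : ptopologicalType) :
  measurable_fun setT (fst : borel (T * U)%type -> borel T).
Proof. exact: (continuous_borel (@continuous_fst T U)). Qed.

Lemma measurable_snd_borel (T U : ptopologicalType) :
  measurable_fun setT (snd : borel (T * U)%type -> borel U).
Proof. exact: (continuous_borel (@continuous_snd T U)). Qed.

Section product_borel.
Variable R : realType.

(** The balls of radius 1/(n+1) around a dense sequence form a countable base. *)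
Lemma polish_base (T : ptopologicalType) : polish R T ->
  exists B : nat * nat -> set T, (forall k, open (B k)) /\
    forall x A, nbhs x A -> exists2 k, B k x & B k `<=` A.
Proof.
move=> [/separable_seq[s sP] [d [[d0 dC dT] nb _]]].
have o x e : open [set y | d x y < e].
  rewrite openE => y /= xy; apply/nb; exists (e - d x y); first by rewrite subr_gt0.
  by move=> z /= yz; rewrite (le_lt_trans (dT _ y _))// addrC -ltrBrDr.
exists (fun k => [set y | d (s k.1) y < k.2.+1%:R^-1]); split => [k|x A].
  exact: o.
move=> /nb[e e0 eA]; have e2 : 0 < e / 2 by rewrite divr_gt0.
(* A ball of radius below e / 2 that contains x lies in the e-ball around x. *)
have [k _ /(_ k (leqnn k)) /= ke] := near_infty_natSinv_lt (PosNum e2).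
have [|//|n /= xn] := sP [set y | d x y < k.+1%:R^-1].
  by exists x; rewrite /= (d0 x x).2.
exists (n, k); first by rewrite /= dC.
move=> y /= ny; apply: eA; rewrite /= (le_lt_trans (dT _ (s n) _))//.
by rewrite (splitr e) ltrD//; apply: lt_trans ke.
Qed.

(** Countable bases make every open set of the product a countable union of open rectangles, so
    Borel sets of the product lie in the product sigma-algebra. *)
Lemma measurable_pair_borel (T U : ptopologicalType) : polish R T -> polish R U ->
  measurable_fun setT (fun z : borel T * borel U => z : borel (T * U)%type).
Proof.
move=> /polish_base[B [oB BP]] /polish_base[C [oC CP]].
apply: (@measurability _ _ _ (borel (T * U)%type) setT _ (@open (T * U)%type) erefl).
move=> _ [W oW <-]; rewrite setTI.
rewrite (_ : _ @^-1` W = \bigcup_(k : (nat * nat) * (nat * nat))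
    if `[< B k.1 `*` C k.2 `<=` W >] then B k.1 `*` C k.2 else set0); last first.
  apply/seteqP; split => [z /= Oz|z [k _]]; last first.
    by case: asboolP => // sub; apply: sub.
  have : nbhs z W by exact: open_nbhs_nbhs.
  move=> [[P Q] /= [/BP[i Bi iP] /CP[j Cj jQ]] PQ].
  exists (i, j) => //=; rewrite asboolT//.
  by move=> y [/iP ? /jQ ?]; exact: PQ.
apply: countable_bigcupT_measurable => // k; case: ifP => // _.
by apply: measurableX; apply: sub_sigma_algebra.
Qed.
End product_borel.

(** * Costs of plans and upper bounds for [GW] *)

Section GW.
Variable R : realType.
Implicit Types X Y Z : gmspace R.

Lemma measurable_gauge X :
  measurable_fun setT (gm_gauge X : borel X * borel X -> R).
Proof.
by have [_] := gm_axiom X; rewrite inE => /andP[]; rewrite inE.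
Qed.
Arguments measurable_gauge : clear implicits.

Lemma gauge_sqr_integral X :
  (\int[(gm_meas X \x gm_meas X)%E]_z (gm_gauge X z ^+ 2)%:E < +oo)%E.
Proof.
have [_ /Lfun2_integrable_sqr/integrableP[_] + _] := gm_axiom X.
by under eq_integral => z _ do rewrite /= ger0_norm ?sqr_ge0//.
Qed.

Section cost.
Context d (T : measurableType d) (X Y : gmspace R) (f1 : T -> X) (f2 : T -> Y).

(** Stated for maps out of an arbitrary space, so that several plans can be compared on one common
    gluing. *)
Definition cost (z : T * T) : R :=
  gm_gauge X (f1 z.1, f1 z.2) - gm_gauge Y (f2 z.1, f2 z.2).

Hypotheses (mf1 : measurable_fun setT (f1 : T -> borel X))
  (mf2 : measurable_fun setT (f2 : T -> borel Y)).

Lemma measurable_cost : measurable_fun setT cost.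
Proof.
apply: measurable_funB.
  exact: (measurableT_comp (measurable_gauge X) (measurable_pair_square mf1)).
exact: (measurableT_comp (measurable_gauge Y) (measurable_pair_square mf2)).
Qed.
End cost.
Arguments cost {d T} X Y f1 f2 z.

(** Tonelli turns the iterated integral into one over the product, where Minkowski and change of
    variables apply. *)
Lemma F_GW_L2norm X Y (p : probability (borel (X * Y)%type) R) :
  F_GW X Y p = L2norm (p \x p)%E (cost (T := borel (X * Y)%type) X Y fst snd).
Proof.
rewrite /F_GW /L2norm; congr sqrte.
rewrite fubini_tonelli1/=; last 2 first.
- apply: measurable_sqr; apply: measurable_cost.
    exact: measurable_fst_borel.
  exact: measurable_snd_borel.
- by move=> z; rewrite lee_fin sqr_ge0.
apply: eq_integral => z _; apply: eq_integral => z' _.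
by rewrite real_normK ?num_real.
Qed.

Lemma GW_ge0 X Y : (0 <= GW X Y)%E.
Proof. by apply: le_ereal_inf_tmp => _ [p _ <-]; exact: sqrte_ge0. Qed.

(** The joint law of [f1] and [f2] is a coupling, and its cost is the right-hand side. *)
Lemma GW_le X Y d (T : measurableType d) (mu : probability T R)
    (f1 : T -> X) (f2 : T -> Y) :
  measurable_fun setT (fun t => (f1 t, f2 t) : borel (X * Y)%type) ->
  (forall A : set (borel X), measurable A -> mu (f1 @^-1` A) = gm_meas X A) ->
  (forall A : set (borel Y), measurable A -> mu (f2 @^-1` A) = gm_meas Y A) ->
  (GW X Y <= L2norm (mu \x mu)%E (cost X Y f1 f2))%E.
Proof.
move=> mf h1 h2.
pose F : {mfun T >-> borel (X * Y)%type} :=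
  HB.pack (fun t => (f1 t, f2 t) : borel (X * Y)%type)
    (isMeasurableFun.Build _ _ _ _ _ mf).
pose p : probability (borel (X * Y)%type) R := distribution mu F.
apply: (@le_trans _ _ (F_GW X Y p)).
  by apply: ereal_inf_lbound; exists p.
rewrite F_GW_L2norm (@L2norm_law _ _ _ _ _ mu p _ mf)//.
apply: measurable_cost.
  exact: measurable_fst_borel.
exact: measurable_snd_borel.
Qed.
End GW.

Arguments measurable_gauge {R} X _ _.
Arguments cost {R d T} X Y f1 f2 z.

(** If [A] is a null set containing the exceptions, the pairs to avoid lie in the null strips A x T
    and T x A. *)
Lemma ae_pair_square d (T : measurableType d) (R : realType) (m : probability T R)
    (P : T -> Prop) :
  {ae m, forall x, P x} -> {ae (m \x m)%E, forall z, P z.1 /\ P z.2}.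
Proof.
move=> [A [mA A0 PA]].
have mAT : measurable (A `*` [set: T]) by exact: measurableX.
have mTA : measurable ([set: T] `*` A) by exact: measurableX.
exists ((A `*` setT) `|` (setT `*` A)); split.
- exact: measurableU.
- apply: null_set_setU => //.
    by rewrite -[RHS](mul0e (m setT)) -A0; exact: product_measure1E.
  by rewrite -[RHS](mule0 (m setT)) -A0; exact: product_measure1E.
move=> z /= nP; have [Pz|Pz] := pselect (P z.1); last by left; split => //; exact: PA.
by right; split => //; apply: PA => Pz2; apply: nP.
Qed.

(** * The triangle inequality at the level of couplings *)

Section GW_metric.
Variable R : realType.
Implicit Types X Y Z : gmspace R.

(* Gluing p and q only along the blocks of a partition of Y gives points
   (x, y, y', z) with y and y' in the same block; the gauge of Y cannot tell
   them apart up to its distance to a block function. *)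
Lemma GW_triangle_coupling X Y Z (p : probability (borel (X * Y)%type) R)
    (q : probability (borel (Y * Z)%type) R) : coupling X Y p -> coupling Y Z q ->
  (GW X Z <= F_GW X Y p + F_GW Y Z q)%E.
Proof.
move=> [pX pY] [qY qZ]; apply/lee_addgt0Pr => e e0.
have [_ ap] := block_approx_L2 (measurable_gauge Y) (gauge_sqr_integral Y).
(* The approximation error of the gauge of [Y] is paid twice, at y and at y'; it is squared below
   because block errors are integrals of squares. *)
have e2 : 0 < e / 2 by rewrite divr_gt0.
have [c [s [mc hs]]] := ap ((e / 2) ^+ 2) (exprn_gt0 _ e2).
pose r (w : borel Y * borel Y) : R := gm_gauge Y w - s (c w.1, c w.2).
have mr : measurable_fun setT r.
  by apply: measurable_funB; [exact: measurable_gauge|exact: (measurable_block s mc)].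
have re : (L2norm (gm_meas Y \x gm_meas Y)%E r <= (e / 2)%:E)%E.
  by apply: lee_sqrE; rewrite ?L2norm_sqr// lee_fin ltW.
pose A := borel (X * Y)%type; pose B := borel (Y * Z)%type.
have m1 (T U : ptopologicalType) := @measurable_fst_borel T U.
have m2 (T U : ptopologicalType) := @measurable_snd_borel T U.
have mu k : measurable ((c \o snd : A -> nat) @^-1` [set k]).
  by rewrite -[X in measurable X]setTI; exact: (m2 X Y measurableT _ (mc k)).
have mv k : measurable ((c \o fst : B -> nat) @^-1` [set k]).
  by rewrite -[X in measurable X]setTI; exact: (m1 Y Z measurableT _ (mc k)).
have uv k : p ((c \o snd : A -> nat) @^-1` [set k]) = q ((c \o fst : B -> nat) @^-1` [set k]).
  by transitivity (gm_meas Y (c @^-1` [set k])); [exact: pY|exact/esym/qY].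
have [G [Gp Gq Guv]] := discrete_gluing mu mv uv.
pose f1 (t : A * B) : borel X := t.1.1; pose f2 (t : A * B) : borel Y := t.1.2.
pose f3 (t : A * B) : borel Y := t.2.1; pose f4 (t : A * B) : borel Z := t.2.2.
have mf1 : measurable_fun setT f1 by exact: (measurableT_comp (m1 X Y) measurable_fst).
have mf2 : measurable_fun setT f2 by exact: (measurableT_comp (m2 X Y) measurable_fst).
have mf3 : measurable_fun setT f3 by exact: (measurableT_comp (m1 Y Z) measurable_snd).
have mf4 : measurable_fun setT f4 by exact: (measurableT_comp (m2 Y Z) measurable_snd).
have l1 C : measurable C -> G (f1 @^-1` C) = gm_meas X C.
  move=> mC; rewrite -pX//; apply: (Gp (fst @^-1` C)).
  by rewrite -[X in measurable X]setTI; exact: (m1 X Y).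
have l2 C : measurable C -> G (f2 @^-1` C) = gm_meas Y C.
  move=> mC; rewrite -pY//; apply: (Gp (snd @^-1` C)).
  by rewrite -[X in measurable X]setTI; exact: (m2 X Y).
have l3 C : measurable C -> G (f3 @^-1` C) = gm_meas Y C.
  move=> mC; rewrite -qY//; apply: (Gq (fst @^-1` C)).
  by rewrite -[X in measurable X]setTI; exact: (m1 Y Z).
have l4 C : measurable C -> G (f4 @^-1` C) = gm_meas Z C.
  move=> mC; rewrite -qZ//; apply: (Gq (snd @^-1` C)).
  by rewrite -[X in measurable X]setTI; exact: (m2 Y Z).
(* The two coordinates come from different factors of [A * B], which gives measurability for the
   product sigma-algebra; Polishness upgrades it to the Borel one. *)
have mf14 : measurable_fun setT (fun t => (f1 t, f4 t) : borel (X * Z)%type).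
  have [[pX' _ _] [pZ' _ _]] := (gm_axiom X, gm_axiom Z).
  apply: (measurableT_comp (measurable_pair_borel pX' pZ')).
  by apply/measurable_fun_pairP; split.
apply: (le_trans (GW_le mf14 l1 l4)).
have mc1 := measurable_cost mf1 mf2.
have mc2 := measurable_cost mf3 mf4.
pose b z := r (f2 z.1, f2 z.2); pose b' z := r (f3 z.1, f3 z.2).
have mb : measurable_fun setT b := measurableT_comp mr (measurable_pair_square mf2).
have mb' : measurable_fun setT b' := measurableT_comp mr (measurable_pair_square mf3).
(* The two costs leave over the gauge of [Y] at y minus that at y'. Almost everywhere this is b -
   b', since the block terms in [r] cancel when y and y' share a block. *)
rewrite (ae_eq_L2norm (g := (cost X Y f1 f2 \+ cost Y Z f3 f4) \+ (b \+ (fun z => - b' z)))).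
- apply: (le_trans (L2normD _ _ _)).
  + exact: measurable_funD.
  + by apply: measurable_funD => //; exact: measurable_funN.
  apply: leeD.
    apply: (le_trans (L2normD _ mc1 mc2)).
    by rewrite !F_GW_L2norm leeD// le_eqVlt; apply/orP; left; apply/eqP/esym;
      [apply: (L2norm_law measurable_fst Gp)|apply: (L2norm_law measurable_snd Gq)];
      apply: measurable_cost; (exact: m1 || exact: m2).
  apply: (le_trans (L2normD _ mb (measurable_funN mb'))).
  rewrite L2normN (_ : e = e / 2 + e / 2); last by field.
  by rewrite EFinD leeD// (le_trans _ re)// le_eqVlt; apply/orP; left; apply/eqP/esym;
    [exact: (L2norm_law mf2 l2)|exact: (L2norm_law mf3 l3)].
- exact: measurable_cost.
- by do 2 apply: measurable_funD => //; exact: measurable_funN.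
have : {ae G, forall t, c t.1.2 = c t.2.1} by exact: Guv.
move/ae_pair_square; apply: filterS => z [/= c1 c2].
rewrite /b /b' /r /cost /f1 /f2 /f3 /f4 /= c1 c2; ring.
Qed.
End GW_metric.

(** * [GW] as a pseudometric and its passage to classes *)

Section GW_pseudometric.
Variable R : realType.
Implicit Types X Y Z : gmspace R.

(** Couplings within e / 2 of each infimum exist once both distances are finite, so infinite values
    are treated first. *)
Lemma GW_triangle X Y Z : (GW X Z <= GW X Y + GW Y Z)%E.
Proof.
have [XYy|XYfin] := eqVneq (GW X Y) +oo%E.
  by rewrite XYy addye ?leey// gt_eqF// (lt_le_trans _ (GW_ge0 Y Z)).
have [YZy|YZfin] := eqVneq (GW Y Z) +oo%E.
  by rewrite YZy addey ?leey// gt_eqF// (lt_le_trans _ (GW_ge0 X Y)).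
have fin (U V : gmspace R) : GW U V != +oo%E -> GW U V \is a fin_num.
  by rewrite ge0_fin_numE ?GW_ge0// ltey.
apply/lee_addgt0Pr => e e0; have e2 : 0 < e / 2 by rewrite divr_gt0.
have [_ [p cp <-] pe] := lb_ereal_inf_adherent e2 (fin _ _ XYfin).
have [_ [q cq <-] qe] := lb_ereal_inf_adherent e2 (fin _ _ YZfin).
apply: (le_trans (GW_triangle_coupling cp cq)).
rewrite (_ : e = e / 2 + e / 2); last by field.
by rewrite EFinD addeACA leeD// ltW.
Qed.

Lemma GW_sym X Y : GW X Y = GW Y X.
Proof.
suff le_sym (U V : gmspace R) : (GW U V <= GW V U)%E.
  by apply/eqP; rewrite eq_le !le_sym.
apply: le_ereal_inf_tmp => _ [q [qV qU] <-].
have msw : measurable_fun setT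
    (fun t : borel (V * U)%type => (t.2, t.1) : borel (U * V)%type).
  exact: (measurable_pairing_borel (@continuous_snd V U) (@continuous_fst V U)).
apply: (le_trans (GW_le msw qU qV)).
rewrite F_GW_L2norm /L2norm le_eqVlt; apply/orP; left; apply/eqP; congr sqrte.
by apply: eq_integral => z _; congr EFin; rewrite /cost; ring.
Qed.

Lemma GW_refl X : GW X X = 0%E.
Proof.
apply/eqP; rewrite eq_le GW_ge0 andbT.
have md : measurable_fun setT (fun x : borel X => (x, x) : borel (X * X)%type).
  by apply: measurable_pairing_borel; move=> x; exact: cvg_id.
apply: (le_trans (GW_le (mu := gm_meas X) md _ _)) => //.
rewrite /L2norm integral0_eq ?sqrte0// => z _.
by rewrite /cost subrr expr0n.
Qed.

Lemma L2norm_gauge_lty X : (L2norm (gm_meas X \x gm_meas X)%E (gm_gauge X) < +oo)%E.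
Proof.
rewrite -ge0_fin_numE ?L2norm_ge0// sqrte_fin_num ?integral_sqr_ge0//.
by rewrite ge0_fin_numE ?integral_sqr_ge0// gauge_sqr_integral.
Qed.

(** By Minkowski the cost of [p] is at most the sum of the L^2 norms of the two gauges. *)
Lemma GW_lty X Y (p : probability (borel (X * Y)%type) R) :
  coupling X Y p -> (GW X Y < +oo)%E.
Proof.
move=> cp; have [pX pY] := cp.
have m1 := @measurable_fst_borel X Y; have m2 := @measurable_snd_borel X Y.
apply: (@le_lt_trans _ _ (F_GW X Y p)); first by apply: ereal_inf_lbound; exists p.
have mg := measurableT_comp (measurable_gauge X) (measurable_pair_square m1).
have mh := measurableT_comp (measurable_gauge Y) (measurable_pair_square m2).
rewrite F_GW_L2norm; apply: (le_lt_trans (L2normD _ mg (measurable_funN mh))).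
rewrite L2normN lte_add_pinfty//.
  by have := L2norm_gauge_lty X; rewrite (L2norm_law m1 pX (measurable_gauge X)).
by have := L2norm_gauge_lty Y; rewrite (L2norm_law m2 pY (measurable_gauge Y)).
Qed.

Lemma GW_homomorphic X X' Y Y' :
  homomorphic X X' -> homomorphic Y Y' -> GW X Y = GW X' Y'.
Proof.
suff le_hom (U U' V V' : gmspace R) : homomorphic U U' -> homomorphic V V' ->
    (GW U V <= GW U' V')%E.
  move=> hX hY; apply/eqP; rewrite eq_le !le_hom//.
    by rewrite /homomorphic GW_sym.
  by rewrite /homomorphic GW_sym.
move=> hU hV; rewrite (le_trans (GW_triangle U U' V))// hU add0e.
by rewrite (le_trans (GW_triangle U' V' V))// (GW_sym V') hV adde0.
Qed.

Lemma gm_classE (A : gmclass R) : gm_class A = homomorphic (gm_repr A).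
Proof. exact: (svalP (cid (gm_classP A))). Qed.

Lemma GW_classE (A B : gmclass R) X Y : A X -> B Y -> GW_class A B = GW X Y.
Proof. by rewrite !gm_classE => hX hY; exact: GW_homomorphic. Qed.

Lemma class_of_self X : class_of X X.
Proof. exact: GW_refl. Qed.

(** By the triangle inequality both classes have the same members; the existence proofs they carry
    are equal by proof irrelevance. *)
Lemma GW_class_eq0 (A B : gmclass R) : GW_class A B = 0%E -> A = B.
Proof.
move=> AB0; suff : gm_class A = gm_class B.
  case: A B {AB0} => [A PA] [B PB] /= AB; subst B.
  by congr GMClass; exact: Prop_irrelevance.
rewrite !gm_classE; apply/funext => X; apply/propext; rewrite /homomorphic.
by rewrite (GW_homomorphic (X' := gm_repr B) (Y' := X))// ?/homomorphic ?GW_refl.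
Qed.
End GW_pseudometric.

(** * The inequality for representatives *)

(** Write h - g_i = (h - m) - (g_i - m) and expand: the cross terms vanish because the weighted
    deviations from m sum to 0. *)
Lemma weighted_variance (R : realFieldType) (N : nat) (rho : 'I_N -> R)
    (g : 'I_N -> R) (h : R) : \sum_i rho i = 1 ->
  \sum_i rho i * (h - g i) ^+ 2 =
  \sum_i rho i * (g i - \sum_j rho j * g j) ^+ 2 + (h - \sum_j rho j * g j) ^+ 2.
Proof.
move=> rho1; set m := \sum_j rho j * g j.
have mean0 : \sum_i rho i * (g i - m) = 0.
  under eq_bigr do rewrite mulrBr.
  by rewrite sumrB -mulr_suml rho1 mul1r subrr.
have -> : \sum_i rho i * (h - g i) ^+ 2 = \sum_i rho i * (g i - m) ^+ 2 +
    (h - m) ^+ 2 * \sum_i rho i - 2 * (h - m) * \sum_i rho i * (g i - m).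
  by rewrite !mulr_sumr -big_split -sumrB; apply: eq_bigr => i _ /=; ring.
by rewrite rho1 mean0 mulr1 mulr0 subr0.
Qed.

Section melting_inequality.
Variables (R : realType) (N : nat) (rho : 'I_N -> R) (X : 'I_N -> gmspace R)
  (Y : gmspace R) (mu : probability (borel (xprod X)) R)
  (omu : optimal_melting Y X mu).
Hypothesis rho_simplex : simplex rho.

Let Z : gmspace R := melting_space rho omu.

Lemma GW_melting_le :
  (\sum_(i < N) (rho i)%:E * GW (X i) Z ^+ 2 + GW Y Z ^+ 2 <=
   \sum_(i < N) (rho i)%:E * GW (X i) Y ^+ 2)%E.
Proof.
have [rho01 rho1] := rho_simplex.
have rho_ge0 i : 0 <= rho i by have /andP[] := rho01 i.
(* Weights summing to 1 force N > 0; the index is used to read off the Y-marginal of [gam]. *)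
have [i0 _] : exists i : 'I_N, true.
  have [N0|N0] := posnP N; last by exists (Ordinal N0).
  have := oner_eq0 R; rewrite -rho1 big1 ?eqxx// => -[k kN] _.
  by exfalso; move: kN; rewrite N0.
have [p po [gam gP muP]] := omu.
pose T := borel (Y * xprod X)%type.
pose fY : T -> borel Y := fst; pose fZ : T -> borel (xprod X) := snd.
pose fX i : T -> borel (X i) := fun t => t.2 i.
have mY : measurable_fun setT fY by exact: measurable_fst_borel.
have mZ : measurable_fun setT fZ by exact: measurable_snd_borel.
have cY := @continuous_fst Y (xprod X); have cZ := @continuous_snd Y (xprod X).
have cX i : continuous (fX i : Y * xprod X -> X i).
  move=> z; apply: (@continuous_comp _ _ _ snd (fun x : xprod X => x i)).
    exact: cZ.
  exact: xprod_proj_continuous.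
have mX i : measurable_fun setT (fX i) := continuous_borel (@cX i).
have mYX i : measurable_fun setT (fun t => (fY t, fX i t) : borel (Y * X i)%type).
  exact: (measurable_pairing_borel cY (@cX i)).
have mYZ : measurable_fun setT (fun t => (fY t, fZ t) : borel (Y * Z)%type).
  exact: (measurable_pairing_borel cY cZ).
have mXZ i : measurable_fun setT (fun t => (fX i t, fZ t) : borel (X i * Z)%type).
  exact: (measurable_pairing_borel (@cX i) cZ).
have lYX i A : measurable A ->
    gam ((fun t : T => (fY t, fX i t) : borel (Y * X i)%type) @^-1` A) = p i A.
  exact: gP.
have mpre d d' (S : measurableType d) (S' : measurableType d') (f : S -> S') A :
    measurable_fun setT f -> measurable A -> measurable (f @^-1` A).
  by move=> mf mA; rewrite -[X in measurable X]setTI; exact: mf.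
have lY A : measurable A -> gam (fY @^-1` A) = gm_meas Y A.
  have [[pY _] _] := po i0; move=> mA; rewrite -(pY A mA).
  by apply: (lYX i0 (fst @^-1` A)); apply: mpre mA; exact: measurable_fst_borel.
have lX i A : measurable A -> gam (fX i @^-1` A) = gm_meas (X i) A.
  have [[_ pX] _] := po i; move=> mA; rewrite -(pX A mA).
  by apply: (lYX i (snd @^-1` A)); apply: mpre mA; exact: measurable_snd_borel.
have lZ A : measurable A -> gam (fZ @^-1` A) = gm_meas Z A by exact: muP.
pose I (f : T * T -> R) := (\int[gam \x gam]_z (f z ^+ 2)%:E)%E.
pose a i := cost Y (X i) fY (fX i); pose b := cost Y Z fY fZ.
pose c i := cost (X i) Z (fX i) fZ.
have sqr_le (u v : \bar R) : (0 <= u)%E -> (u <= v)%E -> (u ^+ 2 <= v ^+ 2)%E.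
  move=> u0 uv; rewrite !expe2; apply: lee_pmul => //.
have YZ : (GW Y Z ^+ 2 <= I b)%E.
  by rewrite /I -L2norm_sqr; apply: sqr_le; [exact: GW_ge0|exact: GW_le].
have XZ i : (GW (X i) Z ^+ 2 <= I (c i))%E.
  rewrite /I -L2norm_sqr; apply: sqr_le; first exact: GW_ge0.
  exact: (GW_le (mXZ i) (lX i) lZ).
(* Optimality of [p i] yields an equality here, whereas [YZ] and [XZ] are mere upper bounds. *)
have XY i : (GW (X i) Y ^+ 2 = I (a i))%E.
  have [cp pmin] := po i.
  have -> : GW (X i) Y = F_GW Y (X i) (p i).
    rewrite GW_sym; apply/eqP; rewrite eq_le; apply/andP; split.
      by apply: ereal_inf_lbound; exists (p i).
    by apply: le_ereal_inf_tmp => _ [q cq <-]; exact: pmin.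
  rewrite F_GW_L2norm (L2norm_law (mYX i) (lYX i)) ?L2norm_sqr//.
  by apply: measurable_cost; [exact: measurable_fst_borel|exact: measurable_snd_borel].
have mb := measurable_sqr (measurable_cost (X := Y) (Y := Z) mY mZ).
have ma i := measurable_sqr (measurable_cost (X := Y) (Y := X i) mY (mX i)).
have mc i := measurable_sqr (measurable_cost (X := X i) (Y := Z) (mX i) mZ).
have sumI (f : 'I_N -> T * T -> R) :
    (forall i, measurable_fun setT (fun z => (f i z ^+ 2)%:E)) ->
    (\sum_i (rho i)%:E * I (f i) =
     \int[gam \x gam]_z (\sum_i (rho i * f i z ^+ 2)%R)%:E)%E.
  move=> mf; under [RHS]eq_integral do rewrite -sumEFin.
  rewrite ge0_integral_sum//.
  - apply: eq_bigr => i _; rewrite -ge0_integralZl ?lee_fin//.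
    by move=> *; rewrite lee_fin sqr_ge0.
  - by move=> i; exact: (measurable_funeM (rho i)%:E (mf i)).
  - by move=> i z _; rewrite lee_fin mulr_ge0 ?sqr_ge0.
rewrite (eq_bigr _ (fun i _ => congr1 (fun x => (rho i)%:E * x)%E (XY i))).
apply: (@le_trans _ _ (\sum_i (rho i)%:E * I (c i) + I b)%E).
  by rewrite leeD// lee_sum// => i _; rewrite lee_wpmul2l ?lee_fin.
rewrite !sumI// -ge0_integralD//.
(* The gauge of [Z] is by definition the weighted mean of the gauges of the [X i], so the integrands
   agree pointwise. *)
- rewrite le_eqVlt; apply/orP; left; apply/eqP; apply: eq_integral => z _.
  rewrite -EFinD; congr EFin.
  exact/esym/(weighted_variance (fun i => gm_gauge (X i) (fX i z.1, fX i z.2))).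
- by move=> z _; rewrite lee_fin sumr_ge0// => i _; rewrite mulr_ge0 ?sqr_ge0.
- apply/measurable_EFinP/measurable_sum => i; apply: measurable_funM => //.
  apply: measurable_funX.
  exact: (measurable_cost (X := X i) (Y := Z) (mX i) mZ).
- by move=> z _; rewrite lee_fin sqr_ge0.
Qed.
End melting_inequality.

(** * The inequality for classes, and barycenters as fixpoints *)

Lemma bary_functional_TB (R : realType) (N : nat) (X : 'I_N -> gmclass R)
    (Y Z : gmclass R) (rho : 'I_N -> R) : simplex rho -> TB rho X Y Z ->
  (bary_functional rho X Z + GW_class Y Z ^+ 2 <= bary_functional rho X Y)%E.
Proof.
move=> rhoS [X0 [Y0 [mu [omu [XX0 YY0 ->]]]]].
have ZZ0 := class_of_self (melting_space rho omu).
rewrite /bary_functional (GW_classE YY0 ZZ0).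
rewrite (eq_bigr _ (fun i _ => congr1 (fun x => (rho i)%:E * x ^+ 2)%E
  (GW_classE (XX0 i) ZZ0))).
rewrite [leRHS](eq_bigr _ (fun i _ => congr1 (fun x => (rho i)%:E * x ^+ 2)%E
  (GW_classE (XX0 i) YY0))).
exact: GW_melting_le.
Qed.

(** Membership in [TB] supplies a coupling of [Y0] with each [X0 i], hence finite distances. This
    later allows cancelling the value at [Z]. *)
Lemma bary_functional_lty (R : realType) (N : nat) (X : 'I_N -> gmclass R)
    (Y Z : gmclass R) (rho : 'I_N -> R) : TB rho X Y Z ->
  (bary_functional rho X Y < +oo)%E.
Proof.
move=> [X0 [Y0 [mu [[p po _] [XX0 YY0 _]]]]].
apply: lte_sum_pinfty => i _.
have [cp _] := po i; rewrite (GW_classE (XX0 i) YY0) GW_sym.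
have fin : GW Y0 (X0 i) \is a fin_num by rewrite ge0_fin_numE ?GW_ge0 ?(GW_lty cp).
by rewrite -(fineK fin) -EFin_expe -EFinM ltry.
Qed.

Theorem theorem6p2 (R : realType) (N : nat) (X : 'I_N -> gmclass R)
    (Y : gmclass R) (rho : 'I_N -> R) (rho_simplex : simplex rho) :
  (forall Z : gmclass R, TB rho X Y Z ->
     (bary_functional rho X Z + GW_class Y Z ^+ 2 <= bary_functional rho X Y)%E)
  /\
  (barycenter rho X Y -> forall Z : gmclass R, TB rho X Y Z -> Z = Y).
Proof.
split=> [Z|baryY Z tbZ]; first exact: bary_functional_TB.
have [rho01 _] := rho_simplex.
have FZ0 : (0 <= bary_functional rho X Z)%E.
  apply: sume_ge0 => i _; have /andP[rho0 _] := rho01 i.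
  by rewrite mule_ge0 ?lee_fin// expe_ge0// GW_ge0.
have ineq := bary_functional_TB rho_simplex tbZ.
have FZfin : bary_functional rho X Z \is a fin_num.
  rewrite ge0_fin_numE// (le_lt_trans _ (bary_functional_lty tbZ))//.
  by apply: le_trans ineq; rewrite leeDl// expe_ge0// GW_ge0.
(* With F the barycenter functional, minimality gives F(Z) + GW(Y, Z)^2 <= F(Y) <= F(Z); cancelling
   the finite F(Z) leaves GW(Y, Z)^2 <= 0. *)
apply/esym/GW_class_eq0/eqP; rewrite eq_le GW_ge0 andbT.
apply: lee_sqrE => //; rewrite [leRHS]expe2 mule0.
by rewrite -(leeD2lE _ _ FZfin) adde0 (le_trans ineq).
Qed.
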